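(* There is an algorithm solving the $(\epsilon,\delta)$-winner determination problem for the STV voting rule with sample complexity $O\!\left(\frac{m^2(m+\log\frac{1}{\delta})}{\epsilon^2}\right)$.
   Context: An election has $n$ voters and $m$ candidates, each vote a complete linear order. Under single transferable vote (STV), in each round the remaining candidate with least plurality score (with respect to votes restricted to the remaining candidates; ties broken by an arbitrary fixed rule) is eliminated, its votes thereby transferring to the next preferred remaining candidate; the candidate remaining after $m-1$ rounds wins. The margin of victory (MOV) is the smallest number of votes that must be changed (others kept unchanged) to change the winner. The $(\epsilon,\delta)$-winner determination problem: given the $n$ votes with MOV at least $\epsilon n$, output the winner with probability at least $1-\delta$ over the algorithm's internal randomness; the algorithm may query full votes of arbitrary voters, and the sample complexity is the number of queried votes. *)

(* Defs.v *)
From HB Require Import structures.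
From mathcomp Require Import all_boot all_order all_algebra all_fingroup.
From mathcomp Require Import reals constructive_ereal.

Set Implicit Arguments.
Unset Strict Implicit.
Unset Printing Implicit Defensive.

Import Order.TTheory GRing.Theory Num.Theory.
Local Open Scope ring_scope.

(* The candidates are 'I_m and the voters are 'I_n.  A complete linear order
   on the candidates is encoded by its rank function: [v c] is the position of
   [c] in the vote [v], position 0 being the most preferred one. *)
Notation vote m := {perm 'I_m}.

Notation profile m n := {ffun 'I_n -> vote m}.

(* [breaks t S T] is the candidate eliminated when S is the set of remaining
   candidates and T is the set of those tied for the least plurality score.
   There is no tie_rule 0, so a tie rule witnesses that there is a candidate. *)
Record tie_rule (m : nat) : Type := TieRule {
  breaks : {set 'I_m} -> {set 'I_m} -> 'I_m;
  breaksP : forall S T : {set 'I_m}, T != set0 -> breaks S T \in T }.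

Section STV.
Variables m n : nat.
Implicit Types (t : tie_rule m) (P Q : profile m n) (S : {set 'I_m}).

(* Meaningful for c in S: the number of voters ranking c first within S. *)
Definition plurality P S (c : 'I_m) : nat :=
  #|[set i : 'I_n | [forall d in S, (P i c <= P i d)%N]]|.

Definition lowest P S : {set 'I_m} :=
  [set c in S | [forall d in S, (plurality P S c <= plurality P S d)%N]].

Definition stv_round t P S : {set 'I_m} := S :\ breaks t S (lowest P S).

Definition stv_remaining t P (k : nat) : {set 'I_m} :=
  iter k (stv_round t P) [set: 'I_m].

Definition stv_wins t P (c : 'I_m) : bool := stv_remaining t P m.-1 == [set c].

Lemma lowest_neq0 P S : S != set0 -> lowest P S != set0.
Proof.
case/set0Pn => c0 c0S; apply/set0Pn.
case: (arg_minnP (P := mem S) (plurality P S) c0S) => c cS cmin.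
exists c; rewrite inE; apply/andP; split; first exact: cS.
by apply/forall_inP => d; apply: cmin.
Qed.

Lemma card_stv_remaining t P k : (k < m)%N -> #|stv_remaining t P k| = (m - k)%N.
Proof.
elim: k => [|k IHk] ltkm; first by rewrite /= cardsT card_ord subn0.
have {}IHk := IHk (ltnW ltkm).
have Sn0 : stv_remaining t P k != set0 by rewrite -card_gt0 IHk subn_gt0 ltnW.
pose x := breaks t (stv_remaining t P k) (lowest P (stv_remaining t P k)).
have: x \in lowest P (stv_remaining t P k) by apply/breaksP/lowest_neq0.
rewrite inE => /andP[xS _].
by rewrite subnS -IHk (cardsD1 x (stv_remaining t P k)) xS.
Qed.

Lemma stv_wins_exists_unique t P : exists! c : 'I_m, stv_wins t P c.
Proof.
have m_gt0 : (0 < m)%N.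
  exact: leq_ltn_trans (leq0n _) (ltn_ord (breaks t set0 set0)).
have : #|stv_remaining t P m.-1| == 1%N.
  by rewrite card_stv_remaining ?prednK // -subn1 subKn.
case/cards1P => c eqc; exists c; split=> [|d]; first by rewrite /stv_wins eqc.
by rewrite /stv_wins eqc => /eqP/set1_inj.
Qed.

Definition changed_votes P Q : nat := #|[set i : 'I_n | Q i != P i]|.

Definition winner_changes t P Q : bool :=
  [exists c : 'I_m, stv_wins t P c && ~~ stv_wins t Q c].

(* The margin of victory is +oo when no change of votes changes the winner,
   that is, when there is a single candidate or no voter. *)
Definition mov (R : realType) t P : \bar R :=
  \big[Order.min/+oo%E]_(Q : profile m n | winner_changes t P Q)
    ((changed_votes P Q)%:R)%:E.

End STV.

(* Randomized adaptive algorithms as decision trees: [Query i f] reads the full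
   vote v of voter i and continues as [f v]; [Draw k f] draws j uniformly from
   'I_k.+1, independently of the past, and continues as [f j]. *)
Inductive algorithm (m n : nat) : Type :=
| Output of 'I_m
| Query of 'I_n & (vote m -> algorithm m n)
| Draw (k : nat) of ('I_k.+1 -> algorithm m n).

(* The probability, over the draws, that the output of A on the profile P
   satisfies W. *)
Fixpoint prob_output (R : realType) (m n : nat) (P : profile m n)
    (W : pred 'I_m) (A : algorithm m n) : R :=
  match A with
  | Output c => (W c)%:R
  | Query i f => prob_output R P W (f (P i))
  | Draw k f => (k.+1%:R)^-1 * \sum_(j < k.+1) prob_output R P W (f j)
  end.

(* Worst case over all answers and all draws; a voter queried several times is
   counted with multiplicity. *)
Fixpoint sample_complexity (m n : nat) (A : algorithm m n) : nat :=
  match A with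
  | Output _ => 0
  | Query _ f => (\max_(v : vote m) sample_complexity (f v)).+1
  | Draw k f => \max_(j < k.+1) sample_complexity (f j)
  end.

Definition solves_winner_determination (R : realType) (m n : nat)
    (t : tie_rule m) (eps delta : R) (A : algorithm m n) : Prop :=
  forall P : profile m n,
    ((eps * n%:R)%:E <= mov R t P)%E ->
    1 - delta <= prob_output R P (stv_wins t P) A.

(* Main.v *)
(** By exponential moments and a union bound over the [2 ^ m * m] pairs of a set
    of candidates and a candidate, [O(m^2 (m + ln (1 / delta)) / eps^2)] uniform
    samples estimate all normalized plurality scores on restricted profiles up to
    [gamma = eps / (4 m)].  Suppose so, and let the run on the sample visit the
    sets S_0, S_1, ... and eliminate x_0, x_1, ...  The sample scores of x_k in
    S_k increase with k, so lowering them by [gamma] and by a term [m - k]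
    that makes them strictly increasing gives thresholds beta_k.  As long as some
    x_k scores more than beta_k in S_k in the true profile, take its supporter in
    S_k that joined it last and exchange x_k in that vote with the runner-up
    within S_k.  Scores in later rounds are unaffected, and in earlier rounds no
    survivor drops to the threshold.  After about [2 gamma n + m] exchanges per
    round, fewer than [eps n] in total, the true run follows the sample run, up to
    the order of candidates that nobody ranks first.  Hence the margin of victory
    forces both winners to agree.  If [n] is too small for the rounding term to be
    negligible, the sample size exceeds [n] and all the voters are queried. *)

Require Import Defs.
From HB Require Import structures.
From mathcomp Require Import all_boot all_order all_algebra all_fingroup.
From mathcomp Require Import all_classical all_reals all_analysis.
From mathcomp Require Import fintype finset ring lra zify.

Set Implicit Arguments.
Unset Strict Implicit.
Unset Printing Implicit Defensive.

Import Order.TTheory GRing.Theory Num.Theory.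
Local Open Scope ring_scope.

(** * Favourites of a vote within a set, and exchanges of two candidates *)

Section Tops.
Variable m : nat.
Implicit Types (S T : {set 'I_m}) (v : vote m) (c d x z : 'I_m).

Definition top S v c : bool := [forall d in S, (v c <= v d)%N].

Lemma topP S v c :
  reflect (forall d, d \in S -> (v c <= v d)%N) (top S v c).
Proof. exact: forall_inP. Qed.

Lemma top_exists S v : S != set0 -> exists2 c, c \in S & top S v c.
Proof.
case/set0Pn => c0 c0S.
case: (arg_minnP (P := mem S) (fun c => v c : nat) c0S) => c cS cmin.
by exists c => //; apply/topP => d; apply: cmin.
Qed.

Lemma vote_anti v c d : (v c <= v d)%N -> (v d <= v c)%N -> c = d.
Proof.
by move=> vcd vdc; apply: (perm_inj (s := v)); apply/val_inj/eqP; rewrite eqn_leq vcd.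
Qed.

Lemma top_unique S v c d :
  c \in S -> d \in S -> top S v c -> top S v d -> c = d.
Proof. by move=> cS dS /topP/(_ d dS) ? /topP/(_ c cS); apply: vote_anti. Qed.

Lemma top_sub S T v c : S \subset T -> top T v c -> top S v c.
Proof. by move=> sST /topP h; apply/topP => d dS; apply/h/(subsetP sST). Qed.

Definition swap v x z : vote m := (tperm x z * v)%g.

Lemma swapE v x z c : swap v x z c = v (tperm x z c).
Proof. by rewrite permM. Qed.

Lemma top_swap_other S v x z c :
  x \in S -> z \in S -> c != x -> c != z -> top S (swap v x z) c = top S v c.
Proof.
move=> xS zS cx cz; have tS d : (tperm x z d \in S) = (d \in S).
  by case: tpermP => // ->; rewrite xS zS.
have Ec : tperm x z c = c by rewrite tpermD 1?eq_sym.
apply/topP/topP => h d dS.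
  by have := h (tperm x z d); rewrite !swapE tpermK Ec tS; apply.
by rewrite !swapE Ec h ?tS.
Qed.

Section FirstTwo.
Variables (S : {set 'I_m}) (v : vote m) (x z : 'I_m).
Hypotheses (xS : x \in S) (zS : z \in S :\ x).
Hypotheses (topx : top S v x) (topz : top (S :\ x) v z).

Lemma swap_not_top T : z \in T -> top T (swap v x z) x = false.
Proof.
move=> zT; apply/negP => /topP/(_ z zT); rewrite !swapE tpermL tpermR => vzx.
have /setD1P[zx zS'] := zS.
by have /eqP := vote_anti vzx (topP _ _ _ topx z zS'); rewrite (negPf zx).
Qed.

(** Only [x] and its runner-up [z] move, and [x] is not in [T]. If [z] is in [T], it led [T] before
    and moves up to the place of [x], so it still leads. *)
Lemma top_swap_below T c :
  T \subset S :\ x -> c \in T -> top T (swap v x z) c = top T v c.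
Proof.
move=> sT cT.
have nx d : d \in T -> d != x by move=> dT; case/setD1P: (subsetP sT d dT).
have inS d : d \in T -> d \in S by move=> dT; case/setD1P: (subsetP sT d dT).
have [zT|zT] := boolP (z \in T); last first.
  have nz d : d \in T -> d != z by apply: contraTneq => ->.
  have E d : d \in T -> tperm x z d = d.
    by move=> dT; rewrite tpermD // eq_sym ?nx ?nz.
  by apply/topP/topP => h d dT; have := h d dT; rewrite !swapE !E.
have [->|cz] := eqVneq c z.
  rewrite (top_sub sT topz); apply/topP => d dT; rewrite !swapE tpermR.
  case: tpermP => [dx|_|_ _]; last exact: (topP _ _ _ topx _ (inS _ dT)).
    by have := nx _ dT; rewrite dx eqxx.
  by [].
have Ec : tperm x z c = c by rewrite tpermD // eq_sym ?nx.
apply/topP/topP => /(_ z zT) h.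
  move: h; rewrite !swapE Ec tpermR => vcx.
  have := vote_anti vcx (topP _ _ _ topx _ (inS _ cT)) => cx.
  by have := nx _ cT; rewrite cx eqxx.
have := vote_anti h (topP _ _ _ topz _ (subsetP sT _ cT)) => E.
by rewrite E eqxx in cz.
Qed.

(** A favourite [c] of [T] cannot be [z], since [x] lies in [T] and is preferred to [z]. Hence [c]
    stays in place, and [T] occupies the same positions as before. *)
Lemma top_swap_above T c :
  S \subset T -> c != x -> top T v c -> top T (swap v x z) c.
Proof.
move=> sST cx tc; have /setD1P[zx zS'] := zS.
rewrite top_swap_other ?(subsetP sST) //.
apply/eqP => cz; move: tc; rewrite cz => /topP/(_ x (subsetP sST _ xS)) vzx.
by have /eqP := vote_anti vzx (topP _ _ _ topx _ zS'); rewrite (negPf zx).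
Qed.

End FirstTwo.

End Tops.

(** * Plurality scores and numbers of changed votes *)

Section Plurality.
Variables m n : nat.
Implicit Types (S T : {set 'I_m}) (P Q : profile m n) (c d x z : 'I_m).

Lemma pluralityE P S c : plurality P S c = (\sum_(i < n) top S (P i) c)%N.
Proof.
rewrite /plurality -sum1dep_card big_mkcond; apply: eq_bigr => i _.
by rewrite -/(top _ _ _); case: (top _ _ _).
Qed.

Lemma plurality_update P Q i S c : (forall j, j != i -> Q j = P j) ->
  (plurality Q S c + top S (P i) c = plurality P S c + top S (Q i) c)%N.
Proof.
move=> eqPQ; rewrite !pluralityE (bigD1 i) //= [in RHS](bigD1 i) //=.
rewrite (eq_bigr (fun j => top S (P j) c : nat)) => [|j ji]; last by rewrite eqPQ.
by rewrite addnAC [RHS]addnAC (addnC (nat_of_bool _)).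
Qed.

Lemma changed_votes_trans P1 P2 P3 :
  (changed_votes P1 P3 <= changed_votes P1 P2 + changed_votes P2 P3)%N.
Proof.
rewrite /changed_votes; apply: leq_trans (leq_card_setU _ _).
apply/subset_leq_card/subsetP => i; rewrite !inE.
by case: (eqVneq (P2 i) (P1 i)) => //= ->.
Qed.

Lemma stv_wins_unique (t : tie_rule m) P c d : stv_wins t P c -> stv_wins t P d -> c = d.
Proof. by rewrite /stv_wins => /eqP -> /eqP/set1_inj. Qed.

End Plurality.

(** * Realizing a prescribed elimination order by exchanges *)

Section Transfer.
Variables (m n r : nat) (S : nat -> {set 'I_m}) (x : nat -> 'I_m) (beta : nat -> nat).
Hypothesis SS : forall k, S k.+1 = S k :\ x k.
Hypothesis xS : forall k, (k < r)%N -> x k \in S k.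
Hypothesis S_neq0 : forall k, (k <= r)%N -> S k != set0.
Hypothesis beta_lt : forall i j, (i < j < r)%N -> (0 < beta i)%N -> (beta i < beta j)%N.
Implicit Types P Q : profile m n.

Lemma chain_sub i j : (i <= j)%N -> S j \subset S i.
Proof.
move/subnK <-; elim: (j - i)%N => // d IHd.
by rewrite addSn SS; apply: subset_trans IHd; rewrite subD1set.
Qed.

Lemma chain_notin i j : (i < j)%N -> x i \notin S j.
Proof. by move=> /chain_sub/subsetP sub; apply/negP => /sub; rewrite SS setD11. Qed.

(** Invariant of the exchanges: once [x j] is also brought down to [beta j], it is the unique lowest
    in [S j]. Rounds with threshold 0 are treated separately, through first places. *)
Definition viable P : Prop := forall j, (j < r)%N -> (0 < beta j)%N ->
  (beta j <= plurality P (S j) (x j))%N /\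
  forall c, c \in S j.+1 -> (beta j < plurality P (S j) c)%N.

(* The voter whose vote is changed is the one that joined the supporters of
   [x k] last, so that [x k] loses support in an earlier round only if it has
   gained no support since. *)
Lemma latest_supporter P k : (0 < plurality P (S k) (x k))%N ->
  exists2 i : 'I_n, top (S k) (P i) (x k) &
    forall j, (j <= k)%N -> top (S j) (P i) (x k) ->
      (plurality P (S k) (x k) <= plurality P (S j) (x k))%N.
Proof.
move=> pos.
pose all_top e := [forall i : 'I_n, top (S k) (P i) (x k) ==> top (S e) (P i) (x k)].
have all_topk : exists e, all_top e by exists k; apply/forallP => i; apply/implyP.
(* [e] is the first round in which all final supporters of [x k] already support it. From [e] on its
   score is at least the one in [S k]; if [e] is positive, some supporter joined only at [e]. *)
case: (ex_minnP all_topk) => e /forallP eP emin.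
have mono j : (e <= j)%N -> (plurality P (S k) (x k) <= plurality P (S j) (x k))%N.
  move=> lej; apply/subset_leq_card/subsetP => i; rewrite !inE => ti.
  exact: top_sub (chain_sub lej) (implyP (eP i) ti).
case: e => [|e] in eP emin mono *.
  case/card_gt0P: pos => i; rewrite inE => ti.
  by exists i => // j _ _; apply: mono.
have : ~~ all_top e by apply/negP => /emin; rewrite ltnn.
rewrite negb_forall => /existsP[i]; rewrite negb_imply => /andP[ti nti].
exists i => // j _ tj; apply: mono; rewrite ltnNge; apply: contra nti => lje.
exact: top_sub (chain_sub lje) tj.
Qed.

Lemma transfer_step P k : viable P -> (k < r)%N ->
  (beta k < plurality P (S k) (x k))%N ->
  exists Q, [/\ viable Q, (changed_votes P Q <= 1)%N,
    (plurality Q (S k) (x k)).+1 = plurality P (S k) (x k) &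
    forall j, (j < r)%N -> j != k ->
      plurality Q (S j) (x j) = plurality P (S j) (x j)].
Proof.
move=> viaP ltkr gtk.
have [|i ti latest] := @latest_supporter P k; first exact: leq_ltn_trans gtk.
have [z zS tz] := top_exists (P i) (S_neq0 ltkr); rewrite SS in zS tz.
pose Q : profile m n := [ffun j => if j == i then swap (P i) (x k) z else P j].
have Qi : Q i = swap (P i) (x k) z by rewrite ffunE eqxx.
have upd T c := @plurality_update m n P Q i T c
  (fun j ji => etrans (ffunE _ j) (ifN_eq _ _ ji)).
have xkS := xS ltkr; have /setD1P[zx zSk] := zS.
have above j c : (j <= k)%N -> c != x k ->
    (plurality P (S j) c <= plurality Q (S j) c)%N.
  move=> lejk cx; have := upd (S j) c; rewrite Qi.
  have := @top_swap_above _ _ _ _ _ xkS zS ti (S j) c (chain_sub lejk) cx.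
  case: (top (S j) (P i) c) => [->|_] //; lia.
have below j c : (k < j)%N -> c \in S j ->
    plurality Q (S j) c = plurality P (S j) c.
  move=> ltkj cS; have := upd (S j) c; rewrite Qi.
  rewrite (top_swap_below ti tz) -?SS ?chain_sub //; lia.
have own j : (j < r)%N -> j != k ->
    plurality Q (S j) (x j) = plurality P (S j) (x j).
  move=> ltjr; rewrite neq_ltn => /orP[ltjk|ltkj]; last by rewrite below ?xS.
  have := upd (S j) (x j); rewrite Qi top_swap_other.
  - lia.
  - exact: (subsetP (chain_sub (ltnW ltjk))).
  - exact: (subsetP (chain_sub (ltnW ltjk))).
  - by apply: contraNneq (chain_notin ltjk) => ->.
  - by apply: contraNneq (chain_notin ltjk) => ->.
have lose (T : {set 'I_m}) : z \in T ->
    (plurality Q T (x k) + top T (P i) (x k) = plurality P T (x k))%N.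
  by move=> zT; have := upd T (x k); rewrite Qi (swap_not_top zS ti) // addn0.
have xkk : (plurality Q (S k) (x k)).+1 = plurality P (S k) (x k).
  by rewrite -(lose _ zSk) ti addn1.
exists Q; split=> //; last first.
  rewrite -(cards1 i); apply/subset_leq_card/subsetP => j.
  by rewrite !inE ffunE; case: (j == i); rewrite ?eqxx.
move=> j ltjr posj; have [bj cj] := viaP j ltjr posj; split.
  by have [->|/own->//] := eqVneq j k; rewrite -ltnS xkk.
move=> c cS; have [ltkj|lejk] := ltnP k j.
  by rewrite below ?cj // (subsetP (chain_sub (leqnSn j))).
have [cx|cx] := eqVneq c (x k); last exact: leq_trans (cj c cS) (above _ _ lejk cx).
rewrite cx in cS *.
have ltjk : (j < k)%N.
  by rewrite ltn_neqAle lejk andbT; apply: contraTneq cS => ->; rewrite SS setD11.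
have zSj : z \in S j := subsetP (chain_sub lejk) _ zSk.
(* If the voter already supported [x k] in [S j], the score there is at least the one in [S k],
   hence at least [beta k + 1], hence at least [beta j + 2]: one loss is affordable. This is where
   strict growth of the thresholds enters. *)
have := lose _ zSj; have [tj|_] := boolP (top (S j) (P i) (x k)).
  have := latest j lejk tj; have := @beta_lt j k; rewrite ltjk ltkr => /(_ isT posj).
  lia.
by rewrite addn0 => ->; apply: cj.
Qed.

(** Induction on the total excess over the thresholds: each exchange lowers it by exactly one and
    changes at most one vote. *)
Lemma transfer P : viable P -> exists Q,
  [/\ viable Q,
      (changed_votes P Q <= \sum_(k < r) (plurality P (S k) (x k) - beta k))%N &
      forall k, (k < r)%N -> (plurality Q (S k) (x k) <= beta k)%N].
Proof.
move eqN: (\sum_(k < r) (plurality P (S k) (x k) - beta k))%N => N.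
elim: N => [|N IHN] in P eqN * => viaP.
  exists P; split=> [//||k ltkr].
    by rewrite leqn0 cards_eq0; apply/eqP/setP => i; rewrite !inE eqxx.
  move/eqP: eqN; rewrite sum_nat_eq0 => /forall_inP/(_ (Ordinal ltkr) isT).
  by rewrite subn_eq0.
have [k ltk] : exists k : 'I_r, (beta k < plurality P (S k) (x k))%N.
  apply/existsP; apply: contra_eqT eqN; rewrite negb_exists => /forallP le.
  by rewrite big1 // => k _; apply/eqP; rewrite subn_eq0 leqNgt.
have [Q [viaQ chQ Qk Qj]] := transfer_step viaP (ltn_ord k) ltk.
have [||Q' [viaQ' chQ' Q'k]] := IHN Q => //.
  have E : (\sum_(j < r | j != k) (plurality Q (S j) (x j) - beta j) =
      \sum_(j < r | j != k) (plurality P (S j) (x j) - beta j))%N.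
    by apply: eq_bigr => j jk; rewrite Qj.
  move: eqN; rewrite (bigD1 k) // [in X in _ -> X = _](bigD1 k) //= E.
  move: (\sum_(_ < _ | _) _)%N => s; move: ltk Qk; lia.
exists Q'; split=> //; apply: leq_trans (changed_votes_trans _ Q _) _.
by rewrite -add1n leq_add.
Qed.

(** * The true elimination run of the modified profile *)

Section Run.
Variables (t : tie_rule m) (Q : profile m n).
Hypotheses (n_gt0 : (0 < n)%N) (S0 : S 0 = [set: 'I_m]) (rE : r = m.-1).
Hypothesis viaQ : viable Q.
Hypothesis leQ : forall k, (k < r)%N -> (plurality Q (S k) (x k) <= beta k)%N.

Lemma chain_r k : (k <= r)%N -> (k < m)%N.
Proof.
move=> lekr; apply: leq_ltn_trans lekr _; rewrite rE prednK //.
exact: leq_ltn_trans (leq0n _) (ltn_ord (x 0)).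
Qed.

Lemma card_chain k : (k <= r)%N -> #|S k| = (m - k)%N.
Proof.
elim: k => [|k IHk] ltkr; first by rewrite S0 cardsT card_ord subn0.
have := cardsD1 (x k) (S k); rewrite xS // -SS IHk 1?ltnW // => E.
by rewrite subnS E.
Qed.

Lemma chain_notinP c k : c \notin S k -> exists2 j, (j < k)%N & c = x j.
Proof.
elim: k => [|k IHk]; first by rewrite S0 inE.
rewrite SS in_setD1 negb_and negbK => /orP[/eqP->|]; first by exists k.
by case/IHk => j ltjk cE; exists j => //; apply: ltnW.
Qed.

Section ZeroPrefix.
Variable K : nat.
Hypotheses (leKr : (K <= r)%N) (beta0 : forall k, (k < K)%N -> beta k = 0%N).
Hypothesis beta_gt0 : (K < r)%N -> (0 < beta K)%N.

(** A candidate [x j] with [j < K] has score 0 in [S j], while an overall favourite stays the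
    favourite of every smaller set containing it. *)
Lemma full_top_late i c : top [set: 'I_m] (Q i) c -> c \in S K.
Proof.
move=> tc; apply: contraT => /chain_notinP[j ltjK cE].
have := leQ (leq_trans ltjK leKr); rewrite beta0 // leqNgt => /negP[].
by apply/card_gt0P; exists i; rewrite inE -cE; apply: top_sub (subsetT _) tc.
Qed.

(** The score of [c] in [S K] is positive: by viability if [K < r], and otherwise because [S K] is a
    singleton and there is a voter. The overall favourite of such a supporter lies in [S K], so it
    is [c]. *)
Lemma late_supporter c : c \in S K -> exists i : 'I_n, top [set: 'I_m] (Q i) c.
Proof.
move=> cS.
have : (0 < plurality Q (S K) c)%N.
  have [ltKr|geKr] := ltnP K r.
    have posK := beta_gt0 ltKr; have [bx bc] := viaQ ltKr posK.
    have [->|cx] := eqVneq c (x K); first exact: leq_trans bx.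
    by apply: ltn_trans posK (bc c _); rewrite SS in_setD1 cx.
  have : #|S K| == 1%N.
    have -> : K = r by apply/eqP; rewrite eqn_leq leKr.
    by rewrite card_chain // rE -subn1 subKn // (leq_ltn_trans (leq0n _) (chain_r (leqnn r))).
  case/cards1P => d SE; move: cS; rewrite SE => /set1P ->.
  apply/card_gt0P; exists (Ordinal n_gt0); rewrite inE.
  by apply/topP => e /set1P ->.
case/card_gt0P => i; rewrite inE => tc; exists i.
have [|d _ td] := @top_exists _ [set: 'I_m] (Q i); first by apply/set0Pn; exists c.
by rewrite (top_unique cS (full_top_late td) tc (top_sub (subsetT _) td)).
Qed.

(* Eliminating a candidate that nobody ranks first leaves all scores unchanged,
   so the order in which these candidates go is irrelevant. *)
Lemma zero_prefix_sub k : (k <= K)%N -> S K \subset stv_remaining t Q k.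
Proof.
elim: k => [|k IHk] ltkK; first exact: subsetT.
have {IHk} := IHk (ltnW ltkK); rewrite [stv_remaining t Q k.+1]/=.
rewrite -/(stv_remaining t Q k); have := @card_stv_remaining m n t Q k.
move: (stv_remaining t Q k) => T /(_ (chain_r (ltnW (leq_trans ltkK leKr)))) cT sST.
(* By counting, some candidate outside [S K] remains. Its score is 0, so the eliminated candidate
   also has score 0 and cannot be in [S K]. *)
have [c cT' cS] : exists2 c, c \in T & c \notin S K.
  apply/subsetPn; apply/negP => /subset_leq_card; rewrite cT card_chain //.
  have := chain_r leKr; lia.
have : breaks t T (lowest Q T) \in lowest Q T.
  by apply/breaksP/lowest_neq0/set0Pn; exists c.
rewrite /stv_round; move: (breaks _ _ _) => b; rewrite inE => /andP[bT /forall_inP/(_ c cT')].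
have -> : plurality Q T c = 0%N.
  apply/eqP; rewrite -leqn0 leqNgt; apply: contra cS => /card_gt0P[i]; rewrite inE => tc.
  have [|d _ td] := @top_exists _ [set: 'I_m] (Q i); first by apply/set0Pn; exists c.
  have dS := full_top_late td.
  by rewrite (top_unique cT' (subsetP sST _ dS) tc (top_sub (subsetT _) td)).
rewrite leqn0 cards_eq0 => /eqP score0; rewrite subsetD1 sST /=.
apply/negP => /late_supporter[i /(top_sub (subsetT T)) tb].
by have := in_set0 i; rewrite -score0 inE => /negP[].
Qed.

Lemma stv_remaining_zero_prefix : stv_remaining t Q K = S K.
Proof.
apply/eqP; rewrite eq_sym eqEcard zero_prefix_sub //=.
by rewrite card_stv_remaining ?card_chain // chain_r.
Qed.

End ZeroPrefix.

(** Let [K] be the first round with positive threshold, or [r]. The two runs agree at [K];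
    afterwards all thresholds are positive, so [x k] is the unique lowest candidate and ties do not
    arise. *)
Lemma stv_remaining_chain : stv_remaining t Q r = S r.
Proof.
have exK : exists k, (r <= k)%N || (0 < beta k)%N by exists r; rewrite leqnn.
case: (ex_minnP exK) => K KP Kmin.
have leKr : (K <= r)%N by apply: Kmin; rewrite leqnn.
have posK : (K < r)%N -> (0 < beta K)%N by rewrite ltnNge; case/orP: KP => [->|].
have zero k : (k < K)%N -> beta k = 0%N.
  move=> ltkK; apply/eqP; rewrite -leqn0 leqNgt; apply/negP => posk.
  by have := Kmin k; rewrite posk orbT leqNgt ltkK => /(_ isT).
suff H d : (K + d <= r)%N -> stv_remaining t Q (K + d) = S (K + d)%N.
  by have := H (r - K)%N; rewrite subnKC //; apply.
elim: d => [|d IHd] led; first by rewrite addn0 stv_remaining_zero_prefix.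
rewrite addnS in led *; rewrite /= -/(stv_remaining t Q (K + d)) IHd 1?ltnW //.
move: (K + d)%N (leq_addr d K) led => k leKk ltkr.
have posk : (0 < beta k)%N.
  move: leKk; rewrite leq_eqVlt => /predU1P[EK|ltKk]; first by rewrite -EK posK ?EK.
  have := posK (ltn_trans ltKk ltkr) => pK; apply: ltn_trans pK _.
  by apply: beta_lt; rewrite ?ltKk // posK // (ltn_trans ltKk).
rewrite SS /stv_round; congr (_ :\ _).
have : breaks t (S k) (lowest Q (S k)) \in lowest Q (S k).
  by apply/breaksP/lowest_neq0/S_neq0/ltnW.
move: (breaks _ _ _) => b; rewrite inE => /andP[bS /forall_inP/(_ _ (xS ltkr)) bx].
apply: contraTeq bx => bx; rewrite -ltnNge; apply: leq_ltn_trans (leQ ltkr) _.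
by apply: (viaQ ltkr posk).2; rewrite SS in_setD1 bx.
Qed.

End Run.

End Transfer.

(** * From uniformly close scores to equal winners *)

Section Winner.
Variables m n : nat.
Implicit Types (t : tie_rule m) (P Q : profile m n).

Definition stv_winner t P : 'I_m :=
  odflt (breaks t set0 set0) [pick c | stv_wins t P c].

Lemma stv_winnerP t P : stv_wins t P (stv_winner t P).
Proof.
rewrite /stv_winner; case: pickP => //= none.
by have [c [cw _]] := stv_wins_exists_unique t P; rewrite none in cw.
Qed.

(** If [c] did not win on [P], then [Q] would change the winner with fewer votes than the margin
    allows. *)
Lemma mov_stv_wins (R : realType) t P Q c (d : R) : (d%:E <= mov R t P)%E ->
  (changed_votes P Q)%:R < d -> stv_wins t Q c -> stv_wins t P c.
Proof.
move=> dP ltd Qc; apply: contraTT isT => nPc.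
have : winner_changes t P Q.
  apply/existsP; exists (stv_winner t P); rewrite stv_winnerP /=.
  by apply: contraNN nPc => /stv_wins_unique/(_ Qc) <-; apply: stv_winnerP.
move=> /(bigmin_le_cond +oo%E (fun Q => ((changed_votes P Q)%:R : R)%:E)) /(le_trans dP).
by rewrite lee_fin leNgt ltd.
Qed.

Lemma plurality_sub P (S T : {set 'I_m}) c :
  S \subset T -> (plurality P T c <= plurality P S c)%N.
Proof.
move=> sST; apply/subset_leq_card/subsetP => i; rewrite !inE.
exact: (@top_sub _ S T (P i) c sST).
Qed.

Lemma changed_votes_le P Q : (changed_votes P Q <= n)%N.
Proof. by rewrite -[leqRHS]card_ord max_card. Qed.

End Winner.

Lemma close_scores_winner (R : realType) (m n l : nat) (t : tie_rule m)
    (P : profile m n) (P' : profile m l) (gamma : R) :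
  (0 < n)%N -> 0 <= gamma ->
  (forall S c, `|(plurality P' S c)%:R / l%:R - (plurality P S c)%:R / n%:R| <= gamma) ->
  exists2 Q : profile m n, stv_wins t Q (stv_winner t P') &
    (changed_votes P Q)%:R <= m.-1%:R * (2 * gamma * n%:R + m%:R + 1).
Proof.
move=> n_gt0 g_ge0 close.
have m_gt0 : (0 < m)%N := leq_ltn_trans (leq0n _) (ltn_ord (breaks t set0 set0)).
pose S k := stv_remaining t P' k; pose x k := breaks t (S k) (lowest P' (S k)).
pose a k : R := (plurality P' (S k) (x k))%:R / l%:R.
(* The term [m - k] is at least 1, so a positive [beta k] lies strictly below the lower bound
   [n (a k - gamma)] on the true score. Negative bounds become 0. *)
pose beta k := (Num.truncn (n%:R * (a k - gamma)) - (m - k))%N.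
have ltm k : (k <= m.-1)%N -> (k < m)%N by rewrite -ltnS prednK.
have S_neq0 k : (k <= m.-1)%N -> S k != set0.
  by move=> /ltm ltkm; rewrite -card_gt0 card_stv_remaining // subn_gt0.
have xlow k : (k < m.-1)%N -> x k \in lowest P' (S k).
  by move=> ltkm; apply/breaksP/lowest_neq0/S_neq0/ltnW.
have xS k : (k < m.-1)%N -> x k \in S k by move=> /xlow; rewrite inE => /andP[].
have xmin k c : (k < m.-1)%N -> c \in S k ->
    (plurality P' (S k) (x k) <= plurality P' (S k) c)%N.
  by move=> /xlow; rewrite inE => /andP[_ /forall_inP]; apply.
have SS k : S k.+1 = S k :\ x k by [].
have n_gt0' : 0 < n%:R :> R by rewrite ltr0n.
pose y k : R := n%:R * (a k - gamma).
have betaP k : (k < m.-1)%N -> (0 < beta k)%N -> (beta k)%:R < y k.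
  move=> ltkm posb; have lt0 : (0 < Num.truncn (y k))%N by move: posb; rewrite /beta /y; lia.
  have y_ge0 : 0 <= y k by move: lt0; rewrite truncn_gt0; apply: le_trans.
  have := truncn_le (y k); rewrite y_ge0; apply: lt_le_trans.
  by rewrite ltr_nat /beta -/(y k); move: (ltm k (ltnW ltkm)); lia.
have P'_lower S' c : n%:R * ((plurality P' S' c)%:R / l%:R - gamma) <= (plurality P S' c)%:R.
  have := close S' c; rewrite ler_norml => /andP[_]; rewrite lerBlDr -lerBlDl => h.
  by rewrite mulrC -ler_pdivlMr.
have P'_upper S' c : (plurality P S' c)%:R <= n%:R * ((plurality P' S' c)%:R / l%:R + gamma).
  have := close S' c; rewrite ler_norml => /andP[h _].
  by rewrite mulrC -ler_pdivrMr //; move: h; lra.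
have amono i j : (i < j < m.-1)%N -> a i <= a j.
  move=> /andP[ltij ltjm]; rewrite /a ler_wpM2r ?invr_ge0 ?ler0n // ler_nat.
  (* In [S i] the candidate [x i] scores at most as much as [x j], and shrinking [S i] to [S j] can
     only raise the score of [x j]. *)
  have sub : S j \subset S i := chain_sub SS (ltnW ltij).
  apply: leq_trans (plurality_sub _ _ sub).
  by apply: xmin; [exact: ltn_trans ltjm | exact: (subsetP sub _ (xS j ltjm))].
have beta_lt i j : (i < j < m.-1)%N -> (0 < beta i)%N -> (beta i < beta j)%N.
  move=> ij; have /andP[ltij ltjm] := ij.
  have : (Num.truncn (y i) <= Num.truncn (y j))%N.
    by apply: le_truncn; rewrite ler_wpM2l ?ler0n // lerB // amono.
  rewrite /beta -/(y i) -/(y j); move: (ltm j (ltnW ltjm)); lia.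
have viaP : viable m.-1 S x beta P.
  move=> j ltjm posj.
  have lt c : c \in S j -> (beta j < plurality P (S j) c)%N.
    move=> cS; rewrite -(ltr_nat R); apply: lt_le_trans (betaP j ltjm posj) _.
    apply: le_trans (P'_lower (S j) c); rewrite ler_wpM2l ?ler0n // lerB //.
    by rewrite /a ler_wpM2r ?invr_ge0 ?ler0n // ler_nat xmin.
  split=> [|c]; first by rewrite ltnW // lt // xS.
  by rewrite SS => /setD1P[_ cS]; apply: lt.
have [Q [viaQ chQ leQ]] := transfer SS xS S_neq0 beta_lt viaP.
exists Q.
  rewrite /stv_wins (@stv_remaining_chain m n m.-1 S x beta) //.
  exact: stv_winnerP.
apply: le_trans (_ : (\sum_(k < m.-1) (plurality P (S k) (x k) - beta k))%:R <= _).
  by rewrite ler_nat.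
have -> : m.-1%:R * (2 * gamma * n%:R + m%:R + 1) =
    \sum_(k < m.-1) (2 * gamma * n%:R + m%:R + 1) :> R.
  by rewrite sumr_const card_ord mulr_natl.
rewrite natr_sum; apply: ler_sum => k _.
have [le|lt] := leqP (plurality P (S k) (x k)) (beta k).
  have -> : (plurality P (S k) (x k) - beta k)%N = 0%N by lia.
  by rewrite !addr_ge0 ?ler0n // !mulr_ge0.
rewrite natrB 1?ltnW //.
(* The bounds [n (a k + gamma)] and [n (a k - gamma)] differ by [2 gamma n]; truncation costs 1 and
   the term [m - k] at most [m]. *)
have up : (plurality P (S k) (x k))%:R <= n%:R * (a k + gamma) := P'_upper (S k) (x k).
have := truncnS_gt (y k); rewrite -natr1 => ylt.
have : (Num.truncn (y k))%:R <= (beta k)%:R + m%:R :> R.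
  by rewrite -natrD ler_nat /beta -/(y k); lia.
by move: up ylt; rewrite /y; lra.
Qed.

(** * Exponential moments, uniform sampling and exhaustive querying *)

Section Sampling.
Variable R : realType.

(** Since [expR (- y) >= 1 - y], it suffices that [(1 - y) (1 + y + 2 y^2) = 1 + y^2 (1 - 2 y)] is
    at least 1. *)
Lemma expR_le_quadratic (y : R) : `|y| <= 1 / 2 -> expR y <= 1 + y + 2 * y ^+ 2.
Proof.
rewrite ler_norml => /andP[ly uy].
have pos : 0 < 1 - y by lra.
rewrite -(ler_pM2r pos).
apply: (@le_trans _ _ 1).
  rewrite -[leRHS](expRxMexpNx_1 y) ler_pM2l ?expR_gt0 //.
  exact: expR_ge1Dx.
by nra.
Qed.

(** The linear term of the quadratic bound averages to 0, leaving [1 + 2 lam^2]. *)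
Lemma mean_expR_le (n : nat) (g : 'I_n.+1 -> R) (lam : R) : 0 <= lam <= 1 / 2 ->
  (forall i, `|g i| <= 1) -> \sum_i g i = 0 ->
  n.+1%:R^-1 * \sum_i expR (lam * g i) <= expR (2 * lam ^+ 2).
Proof.
move=> /andP[l0 l2] g1 g0; apply: le_trans (expR_ge1Dx _).
rewrite mulrC ler_pdivrMr ?ltr0n //.
apply: (@le_trans _ _ (\sum_i (1 + lam * g i + 2 * lam ^+ 2))).
  apply: ler_sum => i _.
  have := @expR_le_quadratic (lam * g i); rewrite normrM ger0_norm // => h.
  apply: le_trans (h _) _; first by rewrite -[leRHS]mulr1 ler_pM.
  rewrite lerD2l exprMn mulrA ler_piMr ?mulr_ge0 ?exprn_ge0 //.
  by rewrite -real_normK ?num_real // expr_le1.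
rewrite !big_split /= -mulr_sumr g0 mulr0 addr0 !sumr_const card_ord.
by rewrite -mulrnDl mulr_natr.
Qed.

Section Sample.
Variables (m n : nat).

Fixpoint sample (decide : seq (vote m) -> 'I_m) (l : nat) (acc : seq (vote m)) :
    algorithm m n.+1 :=
  if l is l'.+1 then
    Draw (fun j : 'I_n.+1 => Query j (fun v => sample decide l' (v :: acc)))
  else Output n.+1 (decide acc).

Lemma sample_complexity_sample decide l acc :
  (sample_complexity (sample decide l acc) <= l)%N.
Proof.
elim: l acc => [|l IHl] acc //=.
by apply/bigmax_leqP => j _; rewrite ltnS; apply/bigmax_leqP => v _.
Qed.

(** Markov's inequality and the union bound over [I], conditionally on the votes [acc] already
    drawn: averaging over one further draw multiplies each exponential moment by at most
    [expR (2 lam^2)]. *)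
Lemma prob_output_sample (I : finType) (P : profile m n.+1) (W : pred 'I_m)
    (g : I -> vote m -> R) (lam b : R) decide l acc :
  0 <= lam <= 1 / 2 ->
  (forall i v, `|g i v| <= 1) -> (forall i, \sum_j g i (P j) = 0) ->
  (forall s, size s = (l + size acc)%N ->
     1 - \sum_i expR (lam * (\sum_(v <- s) g i v) - b) <= (W (decide s))%:R) ->
  1 - \sum_i expR (lam * (\sum_(v <- acc) g i v) - b) * expR (2 * lam ^+ 2 * l%:R)
    <= prob_output R P W (sample decide l acc).
Proof.
move=> lam2 g1 g0; elim: l acc => [|l IHl] acc H /=.
  apply: le_trans (H _ erefl).
  by rewrite mulr0 expR0; under eq_bigr do rewrite mulr1.
apply: (@le_trans _ _ (n.+1%:R^-1 * \sum_(j < n.+1)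
   (1 - \sum_i expR (lam * (\sum_(v <- P j :: acc) g i v) - b) * expR (2 * lam ^+ 2 * l%:R)))).
  rewrite sumrB sumr_const card_ord mulrBr mulVf ?pnatr_eq0 // lerB //.
  rewrite exchange_big /= mulr_sumr; apply: ler_sum => i _.
  rewrite (eq_bigr (fun j => expR (lam * g i (P j)) *
    (expR (lam * (\sum_(v <- acc) g i v) - b) * expR (2 * lam ^+ 2 * l%:R)))); last first.
    by move=> j _; rewrite big_cons [RHS]mulrA -[in RHS]expRD mulrDr addrA.
  rewrite -mulr_suml [leLHS]mulrA.
  have -> : 2 * lam ^+ 2 * l.+1%:R = 2 * lam ^+ 2 + 2 * lam ^+ 2 * l%:R.
    by rewrite -natr1; ring.
  rewrite (expRD (2 * _)) [leRHS]mulrCA ler_wpM2r ?mulr_ge0 ?expR_ge0 //.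
  exact: mean_expR_le.
rewrite ler_wpM2l ?invr_ge0 ?ler0n //; apply: ler_sum => j _.
by apply: IHl => s ss; apply: H; rewrite ss addnS.
Qed.

End Sample.

Section QueryAll.
Variables (m n : nat) (t : tie_rule m).

Fixpoint query_all (s : seq 'I_n) (Q : profile m n) : algorithm m n :=
  if s is i :: s' then
    Query i (fun v => query_all s' [ffun j => if j == i then v else Q j])
  else Output n (stv_winner t Q).

Lemma sample_complexity_query_all s Q :
  (sample_complexity (query_all s Q) <= size s)%N.
Proof.
elim: s Q => [|i s IHs] Q //=; rewrite ltnS.
by apply/bigmax_leqP => v _.
Qed.

Lemma prob_output_query_all P W s Q :
  prob_output R P W (query_all s Q) =
  (W (stv_winner t [ffun j => if j \in s then P j else Q j]))%:R.
Proof.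
elim: s Q => [|i s IHs] Q /=.
  by congr (W (stv_winner t _))%:R; apply/ffunP => j; rewrite ffunE.
rewrite IHs; congr (W (stv_winner t _))%:R; apply/ffunP => j; rewrite !ffunE in_cons.
by case: eqVneq => [->|]; case: ifP.
Qed.

End QueryAll.

End Sampling.

(** * Concentration of all sample scores *)

Definition seq_profile m (s : seq (vote m)) : profile m (size s) :=
  [ffun i => tnth (in_tuple s) i].

Lemma plurality_seq_profile (R : realType) m (s : seq (vote m)) S c :
  (plurality (seq_profile s) S c)%:R = \sum_(v <- s) (top S v c)%:R :> R.
Proof.
rewrite pluralityE natr_sum [RHS]big_tnth.
by apply: eq_bigr => i _; rewrite ffunE.
Qed.

Lemma sample_winner_prob (R : realType) (m n l : nat) (t : tie_rule m)
    (P : profile m n.+1) (gamma : R) (W : pred 'I_m) :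
  (0 < l)%N -> 0 <= gamma <= 2 ->
  (forall l' (P' : profile m l'),
     (forall S c, `|(plurality P' S c)%:R / l'%:R - (plurality P S c)%:R / n.+1%:R| <= gamma) ->
     W (stv_winner t P')) ->
  1 - (2 ^ m * m * 2)%:R * expR (- (l%:R * gamma ^+ 2 / 8)) <=
    prob_output R P W
      (sample n (fun s => stv_winner t (seq_profile s)) l [::]).
Proof.
move=> l_gt0 /andP[ge0 ge2] HW.
have l_gt0' : 0 < l%:R :> R by rewrite ltr0n.
pose p (S : {set 'I_m}) c : R := (plurality P S c)%:R / n.+1%:R.
have p01 S c : 0 <= p S c <= 1.
  rewrite divr_ge0 ?ler0n //= ler_pdivrMr ?ltr0n // mul1r ler_nat.
  by rewrite -[leqRHS]card_ord max_card.
(* The boolean is a sign: both directions of each deviation are covered, whence the factor 2 in the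
   union bound. *)
pose g (i : {set 'I_m} * 'I_m * bool) v : R :=
  (-1) ^+ i.2 * ((top i.1.1 v i.1.2)%:R - p i.1.1 i.1.2).
have sum_g i s : \sum_(v <- s) g i v = (-1) ^+ i.2 *
    ((plurality (seq_profile s) i.1.1 i.1.2)%:R - (size s)%:R * p i.1.1 i.1.2).
  rewrite -mulr_sumr sumrB -plurality_seq_profile; congr (_ * (_ - _)).
  by rewrite big_const_seq count_predT iter_addr_0 mulr_natl.
(* This [lam] minimizes the exponent [2 lam^2 l - lam gamma l], with minimum [- l gamma^2 / 8]. *)
pose lam := gamma / 4; pose b := lam * (gamma * l%:R).
apply: le_trans (_ : 1 - \sum_i expR (lam * (\sum_(v <- [::]) g i v) - b) *
    expR (2 * lam ^+ 2 * l%:R) <= _).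
  rewrite lerD2l lerN2 (eq_bigr (fun=> expR (- (l%:R * gamma ^+ 2 / 8)))); last first.
    by move=> i _; rewrite big_nil -expRD; congr expR; rewrite /b /lam; field.
  have card_sets : #|{: {set 'I_m}}| = (2 ^ m)%N.
    by rewrite -cardsT -powersetT card_powerset cardsT card_ord.
  by rewrite sumr_const !card_prod card_sets card_ord card_bool [leRHS]mulr_natl.
apply: prob_output_sample.
- by rewrite /lam; apply/andP; split; lra.
- move=> i v; rewrite normrM normrX normrN1 expr1n mul1r.
  have /andP[] := p01 i.1.1 i.1.2.
  by case: (top _ _ _) => ? ?; rewrite /= ?mulr1n ?mulr0n ler_norml; apply/andP; split; lra.
- move=> i; rewrite -mulr_sumr sumrB sumr_const card_ord.
  by rewrite -natr_sum -pluralityE -[p _ _ *+ _]mulr_natr /p mulfVK ?pnatr_eq0 // subrr mulr0.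
move=> s; rewrite addn0 => ss.
have [/forallP small|] := boolP [forall i, \sum_(v <- s) g i v <= gamma * l%:R].
  have -> : W (stv_winner t (seq_profile s)); last first.
    by rewrite lerBlDr lerDl sumr_ge0 // => i _; apply: expR_ge0.
  apply: HW => S c; have -> : (size s)%:R = l%:R :> R by rewrite ss.
  rewrite -/(p S c).
  have := small (S, c, true); have := small (S, c, false).
  rewrite !sum_g /= (_ : (size s)%:R = l%:R) ?ss // expr0 expr1 mul1r mulN1r.
  set q := (plurality _ _ _)%:R => h1 h2.
  rewrite ler_norml -(ler_pM2r l_gt0' (- _)) -(ler_pM2r l_gt0' _ gamma) mulrBl divfK ?gt_eqF //.
  by apply/andP; split; move: h1 h2; lra.
rewrite negb_forall => /existsP[i]; rewrite -ltNge => big.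
(* A deviation that is too large makes its own exponential at least 1, so the claimed lower bound is
   at most 0. *)
apply: (@le_trans _ _ 0); last exact: ler0n.
rewrite subr_le0 (bigD1 i) //=; apply: (@le_trans _ _ (expR (lam * (\sum_(v <- s) g i v) - b))).
  by rewrite -expR0 ler_expR subr_ge0 ler_wpM2l ?divr_ge0 // ltW.
by rewrite lerDl sumr_ge0 // => j _; apply: expR_ge0.
Qed.

(** The number of events is at most [16 ^ m], which is at most [expR (4 m)] because
    [2 <= expR 1]. *)
Lemma union_bound_le (R : realType) (m : nat) (delta u : R) : 0 < delta ->
  4 * m%:R + ln (1 / delta) <= u -> (2 ^ m * m * 2)%:R * expR (- u) <= delta.
Proof.
move=> d0; rewrite -lerN2 => le_u.
have [->|m_gt0] := posnP m; first by rewrite muln0 mul0r ltW.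
have le16 : (2 ^ m * m * 2)%:R <= expR (4 * m%:R) :> R.
  have le_nat : (2 ^ m * m * 2 <= (2 ^ 4) ^ m)%N.
    have ltm := ltn_expl m (ltnSn 1).
    have le2 : (2 <= 2 ^ m)%N by rewrite -{1}(expn1 2) leq_exp2l.
    apply: (@leq_trans (2 ^ m * 2 ^ m * 2 ^ m)).
      by apply: leq_mul => //; apply: leq_mul => //; apply: ltnW.
    by rewrite -expnM -!expnD leq_exp2l //; lia.
  rewrite expRM_natr; apply: (@le_trans _ _ ((2 ^ 4) ^ m)%N%:R); first by rewrite ler_nat.
  rewrite natrX lerXn2r ?nnegrE ?expR_ge0 // natrX.
  rewrite -[4]mulr1 expRM_natl lerXn2r ?nnegrE ?expR_ge0 //.
  exact: (expR_ge1Dx 1).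
apply: (@le_trans _ _ (expR (4 * m%:R) * expR (- (4 * m%:R + ln (1 / delta))))).
  by rewrite ler_pM ?expR_ge0 ?ler0n // ler_expR.
rewrite -expRD div1r lnV ?posrE //.
have -> : 4 * m%:R - (4 * m%:R - ln delta) = ln delta by ring.
by rewrite lnK ?posrE.
Qed.

(** * The algorithm, its sample size and its correctness *)

Definition sample_size (R : realType) (m : nat) (eps delta : R) : nat :=
  (Num.truncn (512 * (m%:R ^+ 2 * (m%:R + ln (1 / delta)) / eps ^+ 2))).+1.

(** For [eps > 1] a margin of [eps n] exceeds what changing all votes can achieve, so every profile
    has the same winner and that of a fixed profile is output without any query. *)
Definition stv_algorithm (R : realType) (m n : nat) (t : tie_rule m)
    (eps delta : R) : algorithm m n :=
  let query_only s := query_all t s ([ffun=> 1%g] : profile m n) in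
  if 1 < eps then query_only [::]
  else if (n <= sample_size m eps delta)%N then query_only (enum 'I_n)
  else if n is n'.+1 then
    sample n' (fun s => stv_winner t (seq_profile s)) (sample_size m eps delta) [::]
  else query_all t [::] [ffun=> 1%g].

Lemma sample_size_gt (R : realType) m (eps delta : R) :
  512 * (m%:R ^+ 2 * (m%:R + ln (1 / delta)) / eps ^+ 2) < (sample_size m eps delta)%:R.
Proof. exact: truncnS_gt. Qed.

(** For [eps <= 1] the unscaled bound is at least 1 and absorbs the successor in [sample_size],
    turning 512 into 513. *)
Lemma sample_size_le (R : realType) m (eps delta : R) :
  (0 < m)%N -> 0 < eps <= 1 -> 0 < delta < 1 ->
  (sample_size m eps delta)%:R <=
    513 * (m%:R ^+ 2 * (m%:R + ln (1 / delta)) / eps ^+ 2).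
Proof.
move=> m_gt0 /andP[e0 e1] /andP[d0 d1].
have ln0 : 0 <= ln (1 / delta) by rewrite ln_ge0 // ler_pdivlMr // mul1r ltW.
have m1 : 1 <= m%:R :> R by rewrite ler1n.
rewrite /sample_size; set X := _ / eps ^+ 2.
have X1 : 1 <= X.
  rewrite ler_pdivlMr ?exprn_gt0 // [leLHS]mul1r; apply: (@le_trans _ _ 1).
    by rewrite expr_le1 // ltW.
  by rewrite mulr_ege1 ?exprn_ege1 //; lra.
have X_ge0 : 0 <= 512 * X by apply: mulr_ge0; [exact: ler0n | exact: le_trans X1].
have := truncn_le (512 * X); rewrite X_ge0 => h.
by rewrite -natr1; lra.
Qed.

Lemma solves_stv_algorithm (R : realType) m n (t : tie_rule m) (eps delta : R) :
  0 < eps -> 0 < delta < 1 ->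
  solves_winner_determination t eps delta (stv_algorithm n t eps delta).
Proof.
move=> e0 d01 P movP; have /andP[d0 d1] := d01.
have m_gt0 : (0 < m)%N := leq_ltn_trans (leq0n _) (ltn_ord (breaks t set0 set0)).
have ln0 : 0 <= ln (1 / delta) by rewrite ln_ge0 // ler_pdivlMr // mul1r ltW.
have sure (b : bool) : b -> 1 - delta <= b%:R by move=> ->; rewrite lerBlDr lerDl ltW.
rewrite /stv_algorithm; case: ltP => [e1|e1].
  rewrite prob_output_query_all; apply: sure; set Q := finfun _.
  have [n0|n_gt0] := posnP n.
    have -> : Q = P by apply/ffunP => -[i lti]; exfalso; rewrite n0 in lti.
    exact: stv_winnerP.
  apply: (mov_stv_wins movP _ (stv_winnerP t Q)).
  apply: (@le_lt_trans _ _ n%:R); first by rewrite ler_nat changed_votes_le.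
  by rewrite ltr_pMl // ltr0n.
case: leqP => [_|ltn].
  rewrite prob_output_query_all; apply: sure.
  have -> : [ffun j => if j \in enum 'I_n then P j else [ffun=> 1%g] j] = P.
    by apply/ffunP => j; rewrite ffunE mem_enum.
  exact: stv_winnerP.
case: n P movP ltn => // n P movP; set l := sample_size _ _ _ => ltn.
have lX := sample_size_gt m eps delta; rewrite -/l in lX.
have m1 : 1 <= m%:R :> R by rewrite ler1n.
have m0 : m%:R != 0 :> R by rewrite pnatr_eq0 -lt0n.
pose gamma : R := eps / (4 * m%:R).
have g_ge0 : 0 <= gamma by rewrite divr_ge0 ?mulr_ge0 // ltW.
have e2_gt0 : 0 < eps ^+ 2 by rewrite exprn_gt0.
have lX' : 512 * (m%:R ^+ 2 * (m%:R + ln (1 / delta))) < l%:R * eps ^+ 2.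
  by rewrite -ltr_pdivrMr // -mulrA.
have ltln : l%:R < n.+1%:R :> R by rewrite ltr_nat.
apply: le_trans (_ : 1 - (2 ^ m * m * 2)%:R * expR (- (l%:R * gamma ^+ 2 / 8)) <= _).
  rewrite lerD2l lerN2; apply: union_bound_le => //.
  (* As [512 = 4 * 128], the sample size makes this exponent at least [4 (m + ln (1 / delta))]. *)
  have -> : l%:R * gamma ^+ 2 / 8 = l%:R * eps ^+ 2 / (128 * m%:R ^+ 2).
    by rewrite /gamma; field; rewrite m0.
  rewrite ler_pdivlMr ?mulr_gt0 ?exprn_gt0 ?(lt_le_trans _ m1) //.
  apply: le_trans (ltW lX'); rewrite mulrCA mulrA [512 * _]mulrA.
  have : 0 <= m%:R ^+ 2 * ln (1 / delta) by rewrite mulr_ge0 ?exprn_ge0.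
  by lra.
apply: sample_winner_prob => // [|l' P' close].
  rewrite g_ge0 /= ler_pdivrMr ?mulr_gt0 ?(lt_le_trans _ m1) //; lra.
have [Q Qw chQ] := close_scores_winner t (ltn0Sn n) g_ge0 close.
apply: (mov_stv_wins movP _ Qw); apply: le_lt_trans chQ _.
(* The number of voters exceeds the sample size, so the rounding cost [(m - 1) (m + 1)] is below
   [eps n / 512]; by the choice of [gamma] the main cost is at most [eps n / 2]. *)
have en : 512 * m%:R ^+ 2 < eps * n.+1%:R.
  have : 512 * m%:R ^+ 2 < n.+1%:R * eps ^+ 2.
    apply: le_lt_trans (lt_trans lX' _); last by rewrite ltr_pM2r.
    apply: ler_wpM2l; first exact: ler0n.
    by rewrite ler_peMr ?exprn_ge0 ?ler0n //; lra.
  move=> /lt_le_trans; apply.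
  by rewrite [leLHS]mulrC expr2 -mulrA ler_piMl // mulr_ge0 // ltW.
have -> : m.-1%:R = m%:R - 1 :> R by rewrite -subn1 natrB.
have gE : 2 * gamma * n.+1%:R * m%:R = eps * n.+1%:R / 2 by rewrite /gamma; field.
have : 0 <= 2 * gamma * n.+1%:R by rewrite (mulr_ge0 (mulr_ge0 _ g_ge0)) ?ler0n.
move: gE en; move: (2 * gamma * n.+1%:R) (eps * n.+1%:R) => u e gE en u_ge0.
nra.
Qed.

Theorem theorem12 (R : realType) :
  exists (C : R)
         (A : forall m n : nat, tie_rule m -> R -> R -> algorithm m n),
    0 < C /\
    forall (m n : nat) (t : tie_rule m) (eps delta : R),
      0 < eps -> 0 < delta < 1 ->
      solves_winner_determination t eps delta (A m n t eps delta) /\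
      (sample_complexity (A m n t eps delta))%:R
        <= C * (m%:R ^+ 2 * (m%:R + ln (1 / delta)) / eps ^+ 2).
Proof.
exists 513, (@stv_algorithm R); split=> [|m n t eps delta e0 d01]; first by rewrite ltr0n.
split; first exact: solves_stv_algorithm.
have /andP[d0 d1] := d01.
have m_gt0 : (0 < m)%N := leq_ltn_trans (leq0n _) (ltn_ord (breaks t set0 set0)).
have ln0 : 0 <= ln (1 / delta) by rewrite ln_ge0 // ler_pdivlMr // mul1r ltW.
rewrite /stv_algorithm; case: ltP => [e1|e1] /=.
  apply: mulr_ge0; first exact: ler0n.
  by rewrite divr_ge0 ?exprn_ge0 ?mulr_ge0 ?addr_ge0 ?exprn_ge0 ?ler0n // ltW.
have size_le : (sample_size m eps delta)%:R <= _ :=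
  @sample_size_le R m eps delta m_gt0 (introT andP (conj e0 e1)) d01.
apply: le_trans size_le; rewrite ler_nat.
case: (leqP n (sample_size m eps delta)) => [len|ltn].
  apply: leq_trans (sample_complexity_query_all _ _ _) _.
  by rewrite size_enum_ord.
by case: n ltn => // n _; apply: sample_complexity_sample.
Qed.
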